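(* Let $(A,\|\cdot\|)$ be a normed real nonassociative algebra whose norm satisfies the square inequality, i.e. there is a real number $\eta>0$ such that $\|u^{2}\|\geq \eta\|u\|^{2}$ for all $u\in A$. Then: (i) for every $c\in A$ the filled Julia set $\mathcal{K}_{A}(f_{c})$ associated with $f_{c}$ is a bounded and closed subset of $A$; (ii) the Mandelbrot set $\mathcal{M}_{A}$ is a bounded and closed subset of $A$.
   Context: A real nonassociative algebra is a real vector space $A$ with a bilinear multiplication (not necessarily associative, commutative or unital). All real nonassociative algebras are assumed nonzero and of dimension at least $2$ (possibly infinite-dimensional). A normed real nonassociative algebra is a real nonassociative algebra $A$ with a vector space norm $\|\cdot\|$ that is submultiplicative: $\|uv\|\leq\|u\|\|v\|$ for all $u,v\in A$. For $c\in A$, $f_c:A\to A$ is the map $f_c(u)=u^2+c$ (with $u^2=u\cdot u$); $f_c^{1}=f_c$ and $f_c^{n}(u)=f_c(f_c^{n-1}(u))$. The filled Julia set $\mathcal{K}_A(f_c)$ is the set of all $u\in A$ for which there exists a real $\zeta_u>0$ with $\|f_c^n(u)\|\leq\zeta_u$ for every positive integer $n$. The Mandelbrot set $\mathcal{M}_A$ is the set of all $c\in A$ for which there exists a real $\zeta_c>0$ with $\|f_c^n(0)\|\leq\zeta_c$ for every positive integer $n$. *)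

(* Defs.v *)
From HB Require Import structures.
From mathcomp Require Import all_boot all_order all_algebra.
From mathcomp Require Import sesquilinear.
From mathcomp Require Import all_classical all_reals all_analysis.
Set Implicit Arguments.
Unset Strict Implicit.
Unset Printing Implicit Defensive.
Import Order.TTheory GRing.Theory Num.Theory.
Import numFieldNormedType.Exports.
Local Open Scope classical_set_scope.
Local Open Scope ring_scope.

(* A possibly infinite-dimensional space has dimension at least 2 when it
   contains two linearly independent vectors. *)
Definition dim_ge2 (R : realType) (A : normedModType R) : Prop :=
  exists u v : A, forall a b : R, a *: u + b *: v = 0 -> a = 0 /\ b = 0.

(* The multiplication of a nonassociative algebra A is a bundled bilinear map;
   associativity, commutativity and a unit are not assumed. *)
Definition submultiplicative (R : realType) (A : normedModType R)
    (mul : {bilinear A -> A -> A}) : Prop :=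
  forall u v : A, `|mul u v| <= `|u| * `|v|.

Definition square_inequality (R : realType) (A : normedModType R)
    (mul : {bilinear A -> A -> A}) : Prop :=
  exists2 eta : R, 0 < eta & forall u : A, eta * `|u| ^+ 2 <= `|mul u u|.

Definition quad_map (R : realType) (A : normedModType R)
    (mul : {bilinear A -> A -> A}) (c u : A) : A := mul u u + c.

Definition filled_julia (R : realType) (A : normedModType R)
    (f : A -> A) : set A :=
  [set u | exists2 zeta : R, 0 < zeta &
     forall n : nat, (0 < n)%N -> `|iter n f u| <= zeta].

Definition mandelbrot (R : realType) (A : normedModType R)
    (mul : {bilinear A -> A -> A}) : set A :=
  [set c | exists2 zeta : R, 0 < zeta &
     forall n : nat, (0 < n)%N -> `|iter n (quad_map mul c) 0| <= zeta].

(* Main.v *)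
Require Import Defs.
From HB Require Import structures.
From mathcomp Require Import all_boot all_order all_algebra.
From mathcomp Require Import sesquilinear lra.
From mathcomp Require Import all_classical all_reals all_analysis.
Set Implicit Arguments.
Unset Strict Implicit.
Unset Printing Implicit Defensive.
Import Order.TTheory GRing.Theory Num.Theory.
Import numFieldNormedType.Exports.
Local Open Scope classical_set_scope.
Local Open Scope ring_scope.

(** The square inequality gives an escape radius. If [eta * |u|^2 <= |u^2|] and
    [|u| >= max |c| (3 / eta)], then
    [|u^2 + c| >= (eta * |u|) * |u| - |c| >= 3 * |u| - |u| = 2 * |u|]
    ([quad_map_expands]). From such a point the orbit grows geometrically, so a
    bounded orbit stays strictly inside the ball of radius [max |c| (3 / eta)]
    ([bounded_orbit_lt_radius]). Hence boundedness of an orbit by some constant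
    is boundedness by this explicit one, and the filled Julia set is contained
    in the ball of that radius.

    For the Mandelbrot set the radius would vary with [c], but the critical
    orbit passes through [c] itself: strictness forbids [|c| >= 3 / eta], as
    the radius would then be [|c|]. So the radius is [3 / eta] throughout
    the Mandelbrot set, which is the set of those [c] whose whole critical
    orbit has norm at most [3 / eta] ([mandelbrotE]).

    Both sets are thereby intersections over [n] of sets [{x | |g_n x| <= r}]
    with [r] fixed. Submultiplicativity makes squaring continuous, so all the
    [g_n], being iterates of [u |-> u^2 + c] viewed as functions of [u] or of
    [c], are continuous and the intersections are closed. *)

Lemma closed_norm_le_all (R : realType) (A : normedModType R)
    (T : topologicalType) (g : nat -> T -> A) (r : R) :
  (forall n, continuous (g n)) -> closed [set x | forall n, `|g n x| <= r].
Proof.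
move=> cg.
rewrite (_ : [set x | _] =
    \bigcap_(n in setT) ((fun x => `|g n x|) @^-1` [set y | y <= r])); last first.
  by apply/seteqP; split=> [x xr n _|x xr n]; [exact: xr|exact: (xr n I)].
apply: closed_bigI => n _; apply: closed_comp; last exact: closed_le.
by move=> x _; apply: cvg_norm; exact: cg.
Qed.

(** * Escape of orbits *)

Lemma iter_expands (R : realType) (A : normedModType R) (f : A -> A) (r : R) :
  (forall u, r <= `|u| -> 2 * `|u| <= `|f u|) ->
  forall n u, r <= `|u| -> 2 ^+ n * `|u| <= `|iter n f u|.
Proof.
move=> fr; elim=> [|n IHn] u ru; first by rewrite expr0 mul1r.
have fu := fr _ ru.
rewrite iterSr exprSr -mulrA; apply: le_trans (IHn (f u) _).
  by rewrite ler_pM2l// exprn_gt0.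
by have := normr_ge0 u; lra.
Qed.

(** Applied to the tail of the orbit that starts at the [n]-th iterate: a tail
    that starts at norm at least [r] has norm at least [2 ^ m * r] after [m]
    steps, which passes any bound [z]. *)
Lemma bounded_orbit_lt_radius (R : realType) (A : normedModType R)
    (f : A -> A) (r : R) (u : A) :
  0 < r -> (forall u, r <= `|u| -> 2 * `|u| <= `|f u|) ->
  filled_julia f u -> forall n, `|iter n f u| < r.
Proof.
move=> r0 fr [z z0 uz] n; rewrite ltNge; apply/negP => run.
set m := (Num.bound (z / r)).+1.
have zm : z / r < 2 ^+ m by apply: upper_nthrootP; exact: leqnSn.
have := iter_expands fr m run; rewrite -iterD => em.
have /(le_trans em) : `|iter (m + n) f u| <= z by apply: uz.
apply/negP; rewrite -ltNge.
rewrite ltr_pdivrMr// in zm; apply: (lt_le_trans zm).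
by rewrite ler_pM2l// exprn_gt0.
Qed.

(** The constant 3 leaves a factor 2 after [|c|] is subtracted. *)
Lemma quad_map_expands (R : realType) (A : normedModType R)
    (mul : {bilinear A -> A -> A}) (eta : R) (c u : A) :
  0 < eta -> (forall u : A, eta * `|u| ^+ 2 <= `|mul u u|) ->
  Num.max `|c| (3 / eta) <= `|u| -> 2 * `|u| <= `|quad_map mul c u|.
Proof.
move=> eta0 sq; rewrite ge_max => /andP[cu].
rewrite ler_pdivrMr// => u3.
have := lerB_normD (mul u u) c; rewrite -/(quad_map mul c u).
apply: le_trans.
have := sq u; rewrite expr2.
have : 3 * `|u| <= `|u| * eta * `|u| by rewrite ler_wpM2r.
lra.
Qed.

Lemma filled_julia_quadE (R : realType) (A : normedModType R)
    (mul : {bilinear A -> A -> A}) (eta : R) (c : A) :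
  0 < eta -> (forall u : A, eta * `|u| ^+ 2 <= `|mul u u|) ->
  filled_julia (quad_map mul c) =
  [set u | forall n, `|iter n (quad_map mul c) u| <= Num.max `|c| (3 / eta)].
Proof.
move=> eta0 sq.
have r0 : 0 < Num.max `|c| (3 / eta) by rewrite lt_max divr_gt0// orbT.
apply/seteqP; split=> u uK.
  move=> n; apply/ltW; apply: bounded_orbit_lt_radius => // v.
  exact: quad_map_expands.
by exists (Num.max `|c| (3 / eta)) => // n _; exact: uK.
Qed.

Lemma mandelbrotE (R : realType) (A : normedModType R)
    (mul : {bilinear A -> A -> A}) (eta : R) :
  0 < eta -> (forall u : A, eta * `|u| ^+ 2 <= `|mul u u|) ->
  mandelbrot mul =
  [set c | forall n, `|iter n (quad_map mul c) 0| <= 3 / eta].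
Proof.
move=> eta0 sq; have r0 : 0 < 3 / eta by rewrite divr_gt0.
apply/seteqP; split=> c cM; last by exists (3 / eta) => // n _; exact: cM.
have lt_max_orbit n :
    `|iter n (quad_map mul c) 0| < Num.max `|c| (3 / eta).
  apply: bounded_orbit_lt_radius n => //; first by rewrite lt_max r0 orbT.
  by move=> v; exact: quad_map_expands.
(* The first iterate of 0 is c, so the maximum is not attained by |c|. *)
have c3 : `|c| < 3 / eta.
  by have := lt_max_orbit 1%N; rewrite /= /quad_map linear0r add0r lt_max ltxx.
by move=> n; have := lt_max_orbit n; rewrite (max_r (ltW c3)) => /ltW.
Qed.

(** * Continuity of the iterates *)

(** Telescoping [v^2 - u^2 = (v - u) v + u (v - u)] bounds the increment by
    [|v - u| * (|v| + |u|)]. *)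
Lemma square_continuous (R : realType) (A : normedModType R)
    (mul : {bilinear A -> A -> A}) :
  submultiplicative mul -> continuous (fun u => mul u u).
Proof.
move=> sub u; apply/subr_cvg0/norm_cvg0P.
apply: (@squeeze_cvgr _ _ _ _ (cst 0) (fun v => `|v - u| * (`|v| + `|u|))).
- apply: nearW => v; rewrite normr_ge0/=.
  rewrite (_ : mul v v - mul u u = mul (v - u) v + mul u (v - u)); last first.
    by rewrite linearBl linearBr /= addrA subrK.
  apply: le_trans (ler_normD _ _) _; rewrite mulrDr lerD//.
  by rewrite [leRHS]mulrC.
- exact: cvg_cst.
- rewrite -[X in _ --> X](mul0r (`|u| + `|u|)); apply: cvgM.
    by apply/norm_cvg0P/subr_cvg0.
  by apply: cvgD; [apply: cvg_norm|exact: cvg_cst].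
Qed.

(** The parameter and the starting point both vary, so that this covers the
    dynamical plane ([p] constant) and the parameter plane ([s] constant). *)
Lemma iter_quad_map_continuous (R : realType) (A : normedModType R)
    (mul : {bilinear A -> A -> A}) (T : topologicalType) (p s : T -> A) n :
  submultiplicative mul -> continuous p -> continuous s ->
  continuous (fun x => iter n (quad_map mul (p x)) (s x)).
Proof.
move=> sub cp cs; elim: n => [//|n IHn] x.
apply: (@cvgD _ _ _ _ _ (fun y => mul (iter n (quad_map mul (p y)) (s y))
                                       (iter n (quad_map mul (p y)) (s y)))).
  apply: (@continuous_comp _ _ _ _ (fun u => mul u u) x (IHn x)).
  exact: square_continuous.
exact: cp.
Qed.

Theorem theorem3p3 (R : realType) (A : normedModType R)
    (mul : {bilinear A -> A -> A})
    (hdim : dim_ge2 A)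
    (hsub : submultiplicative mul)
    (hsq : square_inequality mul) :
  (forall c : A, bounded_set (filled_julia (quad_map mul c)) /\
                 closed (filled_julia (quad_map mul c))) /\
  (bounded_set (mandelbrot mul) /\ closed (mandelbrot mul)).
Proof.
have [eta eta0 sq] := hsq; split=> [c|]; split.
- rewrite (filled_julia_quadE c eta0 sq).
  exists (Num.max `|c| (3 / eta)); split; first exact: num_real.
  by move=> M rM u uK; apply: le_trans (uK 0%N) (ltW rM).
- rewrite (filled_julia_quadE c eta0 sq); apply: closed_norm_le_all => n.
  apply: (@iter_quad_map_continuous _ _ _ _ (cst c) id) => //.
    exact: cst_continuous.
  by move=> x; exact: cvg_id.
- rewrite (mandelbrotE eta0 sq).
  exists (3 / eta); split; first exact: num_real.
  move=> M rM c cM; have := cM 1%N; rewrite /= /quad_map linear0r add0r => c3.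
  exact: le_trans c3 (ltW rM).
- rewrite (mandelbrotE eta0 sq); apply: closed_norm_le_all => n.
  apply: (@iter_quad_map_continuous _ _ _ _ id (cst 0)) => //.
    by move=> x; exact: cvg_id.
  exact: cst_continuous.
Qed.
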